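(* Let $X$ be a normal, locally compact space. Let $Y$ be a metric topological manifold. Let $(Z_i)_{i\in\mathbb{N}}$ be a family of $X$-avoidable closed subsets of $Y$. Then their union $\bigcup_{i\in\mathbb{N}} Z_i$ is $X$-avoidable.
   Context: A topological space is normal if any two disjoint closed subsets have disjoint neighborhoods. A manifold of dimension $p\in\mathbb{N}$ is a Hausdorff space where every point has a neighborhood homeomorphic to $\mathbb{R}^p$. A metric topological manifold is a metric space whose underlying topological space is a manifold. Avoidability: let $X$ be a topological space, $Y$ a metric space with metric $d$, and $Z\subset Y$. One says that $Z$ is $X$-avoidable (in $Y$) if for any continuous map $f:X\to Y$ and any continuous function $\varepsilon:X\to\mathbb{R}_{>0}$ there exists a continuous map $g:X\to Y$ such that for all $x\in X$, $g(x)\notin Z$ and $d(f(x),g(x))<\varepsilon(x)$. *)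

(* Defs.v *)
From HB Require Import structures.
From mathcomp Require Import all_boot all_order all_algebra.
From mathcomp Require Import all_classical all_reals topology.
Set Implicit Arguments.
Unset Strict Implicit.
Unset Printing Implicit Defensive.
Import Order.TTheory GRing.Theory Num.Theory.
Import numFieldTopology.Exports.

Local Open Scope classical_set_scope.
Local Open Scope ring_scope.

(* The library's [locally_compact [set: X]] asks for a compact neighborhood that
   is moreover closed.  This is strictly stronger when X is not Hausdorff, even
   for a normal space. *)
Definition locally_compact_space (X : topologicalType) : Prop :=
  forall x : X, exists2 K : set X, nbhs x K & compact K.

Definition homeomorphic (S T : topologicalType) : Prop :=
  exists (f : S -> T) (g : T -> S),
    [/\ cancel f g, cancel g f, continuous f & continuous g].

(* The neighborhood U is viewed as the type [set_type U], which carries the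
   topology induced by Y. *)
Definition topological_manifold (R : realType) (p : nat)
    (Y : topologicalType) : Prop :=
  hausdorff_space Y /\
  forall y : Y, exists2 U : set Y,
    nbhs y U & homeomorphic (set_type U) 'rV[R]_p.

Definition avoidable (R : realType) (X : topologicalType) (Y : metricType R)
    (Z : set Y) : Prop :=
  forall (f : X -> Y) (eps : X -> R),
    continuous f -> continuous eps -> (forall x, 0 < eps x) ->
    exists2 g : X -> Y, continuous g &
      forall x, ~ Z (g x) /\ mdist (f x) (g x) < eps x.
Arguments avoidable {R} X {Y} Z.

(* Main.v *)
(* Start from f_0 = f and perturb successively: f_(n+1) avoids Z_n and is
   e_n-close to f_n, where the continuous tolerances e_n at least halve at each
   step, so that every later map stays within 2 e_n of f_n.  The tolerance
   e_(n+1) is a small fraction of the distance from f_(n+1)(x) to Z_n, which is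
   positive because Z_n is closed; hence the limit avoids every Z_n.  The limit
   exists although Y need not be complete: e_0 is a small fraction of the radius
   of a ball around f(x) contained in a compact set.  That radius and the distance
   to Z_n are both instances of the 1-Lipschitz Lebesgue radius of a family of
   sets, namely the compact sets and the single set ~` Z_n. *)
Require Import Defs.
From HB Require Import structures.
From mathcomp Require Import all_boot all_order all_algebra.
From mathcomp Require Import all_classical all_reals topology.
From mathcomp Require Import interval_inference normedtype lra.
Set Implicit Arguments.
Unset Strict Implicit.
Unset Printing Implicit Defensive.
Import Order.TTheory GRing.Theory Num.Theory.
Import numFieldTopology.Exports numFieldNormedType.Exports.
Local Open Scope classical_set_scope.
Local Open Scope ring_scope.

Section LebesgueRadius.
Context {R : realType} {Y : metricType R}.
Implicit Types (C : set (set Y)) (y z : Y).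

(** The cap at 1 keeps the set bounded even when a member of [C] is all of [Y]. It also bounds the
    tolerances uniformly in [x] later on. *)
Definition radii C y : set R :=
  [set r | 0 < r <= 1 /\ exists2 U, C U & ball y r `<=` U].

(* The supremum of the empty set is [0], so the radius vanishes at the points
   that are interior to no member of [C]. *)
Definition lebesgue_radius C y : R := sup (radii C y).

Lemma radii_ub C y : ubound (radii C y) 1.
Proof. by move=> r [/andP[]]. Qed.

Lemma radii_le C y r : radii C y r -> r <= lebesgue_radius C y.
Proof. by move=> Cr; apply: ub_le_sup => //; exists 1; exact: radii_ub. Qed.

Lemma lebesgue_radius_ge0 C y : 0 <= lebesgue_radius C y.
Proof.
have [[r Cr]|] := pselect (radii C y !=set0).
  by apply: le_trans (radii_le Cr); case: Cr => /andP[/ltW].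
by move=> /set0P/negP/negPn/eqP C0; rewrite /lebesgue_radius C0 sup0.
Qed.

Lemma lebesgue_radius_gtP C y r : 0 <= r -> r < lebesgue_radius C y ->
  exists2 s, radii C y s & r < s.
Proof.
move=> r0 rC; apply: sup_gt => //; apply/set0P/eqP => C0.
by move: rC; rewrite /lebesgue_radius C0 sup0 ltNge r0.
Qed.

Lemma lebesgue_radius_le1 C y : lebesgue_radius C y <= 1.
Proof.
rewrite leNgt; apply/negP => /(lebesgue_radius_gtP ler01)[s /radii_ub].
by rewrite leNgt => /negP.
Qed.

(** If the ball of radius [s] at [y] lies in [U], then so does the ball of radius [s - mdist y z] at
    [z]. *)
Lemma lebesgue_radius_lipschitz C y z :
  lebesgue_radius C y <= lebesgue_radius C z + mdist y z.
Proof.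
rewrite leNgt; apply/negP => /lebesgue_radius_gtP[|s [/andP[s0 s1] [U CU yU]]].
  by rewrite addr_ge0 ?lebesgue_radius_ge0 ?mdist_ge0.
have z0 := lebesgue_radius_ge0 C z; have d0 := mdist_ge0 y z.
apply/negP; rewrite -leNgt -lerBlDr.
have [sd|sd] := leP (s - mdist y z) 0; first exact: le_trans z0.
apply: radii_le; split; first by rewrite sd/=; lra.
exists U => // x; rewrite ballEmdist/= => zx; apply: yU.
by rewrite ballEmdist/= (le_lt_trans (metric_triangle y z x))// addrC -ltrBrDr.
Qed.

Lemma lebesgue_radius_continuous C : continuous (lebesgue_radius C).
Proof.
move=> y; apply/cvgrPdist_lt => e e0; near=> z.
have yz : mdist y z < e.
  by near: z; apply: (metricType_numDomainType.cvgr_dist_lt (f := id)) e0;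
  exact: cvg_id.
have := lebesgue_radius_lipschitz C y z; have := lebesgue_radius_lipschitz C z y.
by rewrite (metric_sym z y) ltr_norml; lra.
Unshelve. all: by end_near. Qed.

Lemma lebesgue_radius_gt0 C y U : C U -> nbhs y U -> 0 < lebesgue_radius C y.
Proof.
move=> CU /nbhs_ballP[r /= r0 yU].
apply: (@lt_le_trans _ _ (Num.min r 1)); first by rewrite lt_min r0 ltr01.
apply: radii_le; split; first by rewrite lt_min r0 ltr01/= ge_min lexx orbT.
by exists U => //; apply: subset_trans yU; apply: le_ball; rewrite ge_min lexx.
Qed.

Lemma lebesgue_radius_gt_ball C y r : 0 <= r -> r < lebesgue_radius C y ->
  exists2 U, C U & ball y r `<=` U.
Proof.
move=> r0 /(lebesgue_radius_gtP r0)[s [_ [U CU yU]] rs].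
by exists U => //; apply: subset_trans yU; exact/le_ball/ltW.
Qed.

End LebesgueRadius.

Lemma rV_nbhs_compact (R : realType) (p : nat) (v : 'rV[R]_p) :
  exists2 K : set 'rV[R]_p, nbhs v K & compact K.
Proof.
exists [set w | forall i, `[v ord0 i - 1, v ord0 i + 1]%classic (w ord0 i)].
  apply/nbhs_ballP; exists 1 => //= w [_ vw] i.
  by move: (vw ord0 i); rewrite /ball/= in_itv/= ltr_norml; lra.
apply: (@rV_compact R p (fun i => `[v ord0 i - 1, v ord0 i + 1]%classic)) => i.
exact: segment_compact.
Qed.

Lemma manifold_locally_compact (R : realType) (p : nat) (Y : topologicalType) :
  topological_manifold R p Y -> locally_compact_space Y.
Proof.
move=> [_ chartY] y; have [U yU [h [k [hK _ ch ck]]]] := chartY y.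
pose u : set_type U := exist _ y (mem_set (nbhs_singleton yU)).
have [K uK cK] := rV_nbhs_compact (h u).
(* Open sets of the chart domain are traces on [U] of open sets [W] of [Y]; since [U] is a
   neighborhood of [y], the trace of [W] is one too. *)
have [_ [[W oW <-] /= Wu] WK] : exists2 B, open_nbhs u B & B `<=` h @^-1` K.
  by have := ch u _ uK; rewrite nbhsE.
exists ((val \o k) @` K); last first.
  apply: continuous_compact => //; apply: continuous_subspaceT => w.
  by apply: continuous_comp; [exact: ck|exact: initial_continuous].
have yW : nbhs y W by exact: open_nbhs_nbhs.
apply: filterS (filterI yU yW) => z [Uz Wz].
exists (h (exist _ z (mem_set Uz))); first exact: (WK (exist _ z (mem_set Uz))).
by rewrite /= hK.
Qed.

Section GeometricSteps.
Context {R : realType} {Y : metricType R} (u : nat -> Y) (e : nat -> R).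
Hypothesis e_ge0 : forall n, 0 <= e n.
Hypothesis e_half : forall n, e n.+1 <= e n / 2.
Hypothesis u_step : forall n, mdist (u n) (u n.+1) <= e n.

Lemma geometric_steps_dist n m : (n <= m)%N -> mdist (u n) (u m) <= 2 * e n.
Proof.
(* This sharper bound telescopes: halving gives [e k <= 2 * e k - 2 * e k.+1]. *)
move=> nm; suff : mdist (u n) (u m) <= 2 * e n - 2 * e m.
  by have := e_ge0 m; lra.
rewrite -(subnKC nm); elim: (m - n)%N => [|k IH].
  by rewrite addn0 mdistxx subrr.
rewrite addnS; have := metric_triangle (u n) (u (n + k)) (u (n + k).+1).
by have := u_step (n + k); have := e_half (n + k); lra.
Qed.

(** Any cluster point will do: terms of index at least [n] come arbitrarily close to it, and all of
    them are within [2 * e n] of [u n]. *)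
Lemma geometric_steps_limit (K : set Y) : compact K -> (forall n, K (u n)) ->
  exists l, forall n, mdist (u n) l <= 2 * e n.
Proof.
move=> cK uK; have [l [_ ul]] : K `&` cluster (u @ \oo) !=set0.
  by apply: cK; exists 0%N => // n _; exact: uK.
exists l => n; apply/ler_addgt0Pl => d d0.
have un : (u @ \oo) (u @` [set m | (n <= m)%N]).
  by exists n => // m /= nm; exists m.
have [_ [[m /= nm <-]]] := ul _ _ un (nbhsx_ballx l d d0).
rewrite ballEmdist/= metric_sym => lm.
have := metric_triangle (u n) (u m) l.
by have := geometric_steps_dist nm; lra.
Qed.

End GeometricSteps.

Lemma uniform_dist_limit_continuous (R : realType) (X : topologicalType)
    (Y : metricType R) (f : nat -> X -> Y) (g : X -> Y) :
  (forall n, continuous (f n)) ->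
  (forall d, 0 < d -> exists n, forall x, mdist (f n x) (g x) < d) ->
  continuous g.
Proof.
move=> cf fg x; apply/metricType_numDomainType.cvgrPdist_lt => d d0.
have [|n fgn] := fg (d / 3); first by rewrite divr_gt0.
near=> z.
have fxz : mdist (f n x) (f n z) < d / 3.
  near: z; apply: metricType_numDomainType.cvgr_dist_lt; first exact: cf.
  by rewrite divr_gt0.
have := metric_triangle (g x) (f n x) (g z).
have := metric_triangle (f n x) (f n z) (g z).
by have := fgn x; have := fgn z; rewrite (metric_sym (g x) (f n x)); lra.
Unshelve. all: by end_near. Qed.

Section Avoidance.
Context {R : realType} {X : topologicalType} {Y : metricType R}.
Implicit Types Z : set Y.

Definition admissible (s : (X -> Y) * (X -> R)) : Prop :=
  [/\ continuous s.1, continuous s.2 & forall x, 0 < s.2 x].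

Definition refines Z (s t : (X -> Y) * (X -> R)) : Prop := forall x,
  [/\ mdist (s.1 x) (t.1 x) < s.2 x, t.2 x <= s.2 x / 2 &
      4 * t.2 x <= lebesgue_radius [set ~` Z] (t.1 x)].

Lemma continuous_min_scale (a b : X -> R) (c d : R) :
  continuous a -> continuous b ->
  continuous (fun x => Num.min (a x / c) (b x / d)).
Proof.
move=> ca cb x.
apply: (continuous_min (f := fun x => a x / c) (g := fun x => b x / d)).
  by apply: cvgM; [exact: ca|exact: cvg_cst].
by apply: cvgM; [exact: cb|exact: cvg_cst].
Qed.

Lemma avoidable_refines Z s : closed Z -> avoidable X Z -> admissible s ->
  exists2 t, admissible t & refines Z s t.
Proof.
move=> clZ avZ [cf ce e0]; have [g cg gP] := avZ _ _ cf ce e0.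
pose rho x := lebesgue_radius [set ~` Z] (g x).
have rho0 x : 0 < rho x.
  apply: (@lebesgue_radius_gt0 _ _ _ _ (~` Z)) => //.
  by apply: open_nbhs_nbhs; split; [exact: closed_openC|exact: (gP x).1].
exists (g, fun x => Num.min (s.2 x / 2) (rho x / 4)).
  split=> //= [|x]; last by rewrite lt_min !divr_gt0.
  apply: continuous_min_scale => // x.
  by apply: continuous_comp; [exact: cg|exact: lebesgue_radius_continuous].
move=> x; split=> /=; [exact: (gP x).2|by rewrite ge_min lexx|].
have : Num.min (s.2 x / 2) (rho x / 4) <= rho x / 4 by rewrite ge_min lexx orbT.
by rewrite -/(rho x); lra.
Qed.

Lemma avoidable_bigcup (Z : nat -> set Y) : locally_compact_space Y ->
  (forall i, closed (Z i)) -> (forall i, avoidable X (Z i)) ->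
  avoidable X (\bigcup_i Z i).
Proof.
move=> lcY clZ avZ f eps cf ceps eps0.
pose rho x := lebesgue_radius (@compact Y) (f x).
have rho0 x : 0 < rho x.
  by have [K yK cK] := lcY (f x); exact: lebesgue_radius_gt0 cK yK.
pose s0 := (f, fun x => Num.min (eps x / 4) (rho x / 4)).
have As0 : admissible s0.
  split=> //= [|x]; last by rewrite lt_min !divr_gt0.
  apply: continuous_min_scale => // x.
  by apply: continuous_comp; [exact: cf|exact: lebesgue_radius_continuous].
have /choice[next nextP] (ns : nat * ((X -> Y) * (X -> R))) :
    exists t, admissible ns.2 -> admissible t /\ refines (Z ns.1) ns.2 t.
  (* Choice needs a total function, so inadmissible pairs get a dummy value. *)
  have [As|nAs] := pselect (admissible ns.2); last by exists ns.2.
  by have [t At st] := avoidable_refines (clZ ns.1) (avZ ns.1) As; exists t.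
pose s := fix s n := if n is m.+1 then next (m, s m) else s0.
have As n : admissible (s n).
  by elim: n => // n IH; exact: (nextP (n, s n) IH).1.
have sP n : refines (Z n) (s n) (s n.+1) := (nextP (n, s n) (As n)).2.
pose u x n := (s n).1 x; pose e x n := (s n).2 x.
have e_gt0 x n : 0 < e x n by case: (As n) => _ _; exact.
have e0 x n : 0 <= e x n by exact: ltW.
have e_half x n : e x n.+1 <= e x n / 2 by case: (sP n x).
have u_step x n : mdist (u x n) (u x n.+1) <= e x n.
  by apply: ltW; case: (sP n x).
have e_eps x : e x 0 <= eps x / 4 by rewrite /e/= ge_min lexx.
have e_rho x : e x 0 <= rho x / 4 by rewrite /e/= ge_min lexx orbT.
have /choice[g gP] x : exists y, forall n, mdist (u x n) y <= 2 * e x n.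
  (* All iterates stay within [2 * e x 0 <= rho x / 2] of [f x], hence in a ball that lies in one
     compact set. *)
  have [||K cK fK] :=
    @lebesgue_radius_gt_ball _ _ (@compact Y) (f x) (3 * (rho x / 4)).
  - by rewrite mulr_ge0// divr_ge0// ltW.
  - by have := rho0 x; rewrite -/(rho x); lra.
  apply: (geometric_steps_limit (e0 x) (e_half x) (u_step x) cK) => n.
  apply: fK; rewrite ballEmdist/=.
  have := geometric_steps_dist (e0 x) (e_half x) (u_step x) (leq0n n).
  by have := e_rho x; have := rho0 x; rewrite /u/=; lra.
(* This bound does not depend on [x], so convergence is uniform and [g] is continuous. *)
have e_geo x n : e x n <= (2 ^+ n)^-1.
  elim: n => [|n IH].
    have := e_rho x; have := lebesgue_radius_le1 (@compact Y) (f x).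
    by rewrite -/(rho x) expr0 invr1; lra.
  by rewrite exprS invfM; have := e_half x n; lra.
exists g.
  apply: (@uniform_dist_limit_continuous _ _ _ (fun n => (s n).1)) => [n|d d0].
    by case: (As n).
  have d2 : 0 < d / 2 by rewrite divr_gt0.
  have [n _ /(_ n (leqnn n)) nd] := near_infty_natSinv_expn_lt (PosNum d2).
  exists n => x; have := gP x n; have := e_geo x n.
  by move: nd; rewrite /= div1r /u; lra.
move=> x; split.
  move=> [i _ Zi]; case: (sP i x) => _ _ e_rad.
  have ei := e_gt0 x i.+1.
  (* The map of index [i.+1] is the first one built to avoid [Z i]; its ball of radius
     [3 * e x i.+1] misses [Z i] and contains [g x]. *)
  have [||_ -> subZ] :=
    @lebesgue_radius_gt_ball _ _ [set ~` Z i] (u x i.+1) (3 * e x i.+1).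
  - by rewrite mulr_ge0.
  - by apply: lt_le_trans e_rad; rewrite -/(e x i.+1); lra.
  apply: (subZ (g x)) => //; rewrite ballEmdist/=.
  by have := gP x i.+1; lra.
have := gP x 0; have := e_eps x; have := eps0 x.
by rewrite /u/=; lra.
Qed.

End Avoidance.

Theorem theorem3p6 (R : realType) (X : topologicalType)
    (normalX : normal_space X) (lcX : locally_compact_space X)
    (p : nat) (Y : metricType R) (manifoldY : topological_manifold R p Y)
    (Z : nat -> set Y) (closedZ : forall i, closed (Z i))
    (avoidableZ : forall i, avoidable X (Z i)) :
  avoidable X (\bigcup_i Z i).
Proof.
exact: avoidable_bigcup (manifold_locally_compact manifoldY) closedZ avoidableZ.
Qed.
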